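(* Let $X$ be a Fréchet sequence space over $\mathbb{Z}$ in which the sequence $(e_j)_{j\in\mathbb{Z}}$ of canonical vectors is a basis, let $(\|\cdot\|_k)_{k\in\mathbb{N}}$ be an increasing sequence of seminorms that induces the topology of $X$, let $w=(w_j)_{j\in\mathbb{Z}}$ be a sequence of nonzero scalars, and suppose that the bilateral weighted backward shift $$B_w:(x_j)_{j\in\mathbb{Z}}\in X\mapsto (w_{j+1}x_{j+1})_{j\in\mathbb{Z}}\in X$$ is an invertible operator on $X$. Then $B_w$ is average expansive if and only if there exists $k\in\mathbb{N}$ such that $$\sup_{n\in\mathbb{N}}\Big(\frac1n\sum_{j=1}^n |w_{-j+1}\cdots w_0|\,\|e_{-j}\|_k\Big)=\infty \quad\text{or}\quad \sup_{n\in\mathbb{N}}\Big(\frac1n\sum_{j=1}^n \frac{\|e_j\|_k}{|w_1\cdots w_j|}\Big)=\infty.$$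
   Context: $\mathbb{K}$ denotes $\mathbb{R}$ or $\mathbb{C}$, and $\mathbb{N}=\{1,2,3,\dots\}$. For a locally convex (Hausdorff) space $X$ over $\mathbb{K}$, an operator on $X$ is a continuous linear map $X\to X$; it is invertible if it has a continuous inverse, and $GL(X)$ denotes the set of invertible operators. A Fréchet sequence space over $\mathbb{Z}$ is a Fréchet space $X$ that is a vector subspace of $\mathbb{K}^{\mathbb{Z}}$ such that the inclusion $X\to\mathbb{K}^{\mathbb{Z}}$ is continuous (product topology on $\mathbb{K}^{\mathbb{Z}}$). The canonical vector $e_j$ ($j\in\mathbb{Z}$) has $j$-th coordinate $1$ and all other coordinates $0$. The sequence $(e_j)_{j\in\mathbb{Z}}$ is a basis of $X$ if each $e_j\in X$ and $x=\sum_{j=-\infty}^{\infty}x_je_j$ (convergence in $X$) for all $x=(x_j)_{j\in\mathbb{Z}}\in X$. Average expansivity: if the topology of $X$ is induced by a family $(\|\cdot\|_\alpha)_{\alpha\in I}$ of seminorms, $T\in GL(X)$ is average expansive if for each $x\in X\setminus\{0\}$ there exists $\alpha\in I$ such that $\sup_{n\in\mathbb{N}}\big(\frac{1}{2n+1}\sum_{j=-n}^{n}\|T^jx\|_\alpha\big)=\infty$. (This does not depend on the choice of the family; here one may use $(\|\cdot\|_k)_{k\in\mathbb{N}}$.) *)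

(* Defs.v *)
From HB Require Import structures.
From mathcomp Require Import all_boot all_order all_algebra complex.
From mathcomp Require Import all_classical all_reals all_analysis.

Set Implicit Arguments.
Unset Strict Implicit.
Unset Printing Implicit Defensive.

Import Order.TTheory GRing.Theory Num.Theory.
Import numFieldNormedType.Exports.

Local Open Scope classical_set_scope.
Local Open Scope ring_scope.

Inductive scalar_kind := RealScalars | ComplexScalars.

Definition scalar_field (R : realType) (kd : scalar_kind) : numFieldType :=
  match kd with
  | RealScalars => R
  | ComplexScalars => R[i]
  end.

(* The library norm on R[i] takes its values in R[i]; this one is R-valued. *)
Definition modulus (R : realType) (kd : scalar_kind) : scalar_field R kd -> R :=
  match kd return scalar_field R kd -> R with
  | RealScalars => fun a => `|a|
  | ComplexScalars => @ComplexField.Normc.normc R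
  end.

(* Locally convex spaces whose underlying set is a vector subspace of K^Z,
   namely [set x | P x]; the inclusion is \val.  Its continuity is not required here:
   see is_frechet_sequence_space. *)
#[short(type="tvsSeqType")]
HB.structure Definition TvsSeq (K : numFieldType) (P : pred (int -> K)) :=
  {X of Tvs K X & @GRing.SubLmodule K (int -> K : lmodType K) P X}.

(* \sum_(-m <= j <= n) F j *)
Definition bilateral_sum (V : zmodType) (m n : nat) (F : int -> V) : V :=
  \sum_(i < (m + n).+1) F (i%:Z - m%:Z).

Definition metrizable (R : realType) (X : topologicalType) : Prop :=
  exists d : X -> X -> R,
    [/\ forall x y, d x y = 0 <-> x = y,
        forall x y, d x y = d y x,
        forall x y z, d x z <= d x y + d y z &
        forall x (U : set X),
          nbhs x U <-> exists2 r, 0 < r & [set y | d x y < r] `<=` U].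

(* Completeness for the uniformity that the vector space topology determines:
   tvsType does not force the entourages of X to be translation invariant, so
   the library's cauchy is not used. *)
Definition tvs_cauchy (K : numFieldType) (X : tvsType K) (F : set_system X) :=
  forall U : set X, nbhs 0 U ->
    exists2 A : set X, F A & forall x y, A x -> A y -> U (x - y).

Definition tvs_complete (K : numFieldType) (X : tvsType K) : Prop :=
  forall F : set_system X, ProperFilter F -> tvs_cauchy F ->
    exists x : X, F --> x.

(* Local convexity is part of tvsType, and metrizability implies Hausdorff. *)
Definition is_frechet (R : realType) (K : numFieldType) (X : tvsType K) : Prop :=
  metrizable R X /\ tvs_complete X.

Definition is_frechet_sequence_space (R : realType) (K : numFieldType)
    (P : pred (int -> K)) (X : tvsSeqType P) : Prop :=
  is_frechet R X /\ continuous (\val : X -> prod_topology (fun _ : int => K)).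

Definition canonical_vector (K : numFieldType) (j : int) : int -> K :=
  fun i => (i == j)%:R.

(* Both ends of the bilateral series go to infinity independently. *)
Definition canonical_basis (K : numFieldType) (P : pred (int -> K))
    (X : tvsSeqType P) (e : int -> X) : Prop :=
  (forall j, \val (e j) = canonical_vector K j) /\
  (forall x : X,
     bilateral_sum mn.1 mn.2 (fun j => (\val x : int -> K) j *: e j)
       @[mn --> (\oo, \oo)] --> x).

Definition seminorm (R : realType) (kd : scalar_kind) (X : tvsType (scalar_field R kd))
    (q : X -> R) : Prop :=
  [/\ forall x, 0 <= q x,
      forall x y, q (x + y) <= q x + q y &
      forall a x, q (a *: x) = modulus a * q x].

Definition induces_topology (R : realType) (kd : scalar_kind)
    (X : tvsType (scalar_field R kd)) (I : Type) (p : I -> X -> R) : Prop :=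
  forall (x : X) (U : set X),
    nbhs x U <->
    exists (s : seq I) (r : R),
      0 < r /\ [set y | all (fun i => p i (y - x) < r) s] `<=` U.

Record GL (K : numFieldType) (X : tvsType K) := MkGL {
  gl_fun :> {linear X -> X};
  gl_inv : X -> X;
  gl_fun_continuous : continuous gl_fun;
  gl_inv_continuous : continuous gl_inv;
  gl_funK : cancel gl_fun gl_inv;
  gl_invK : cancel gl_inv gl_fun
}.

Definition gl_pow (K : numFieldType) (X : tvsType K) (T : GL X) (j : int) :
    X -> X :=
  match j with
  | Posz n => iter n T
  | Negz n => iter n.+1 (gl_inv T)
  end.

Definition average_expansive (R : realType) (kd : scalar_kind)
    (X : tvsType (scalar_field R kd)) (I : Type) (p : I -> X -> R) (T : GL X) : Prop :=
  forall x : X, x != 0 ->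
    exists i : I,
      ereal_sup
        [set ((2 * n + 1)%:R^-1
                * bilateral_sum n n (fun j => p i (gl_pow T j x)))%:E
        | n in [set n | (0 < n)%N]] = +oo%E.

Definition weighted_backward_shift (K : numFieldType) (w : int -> K)
    (x : int -> K) : int -> K :=
  fun j => w (j + 1) * x (j + 1).

(* Main.v *)
Require Import Defs.
From HB Require Import structures.
From mathcomp Require Import all_boot all_order all_algebra.
From mathcomp Require Import all_classical all_reals all_analysis.
From mathcomp Require complex.
From mathcomp Require Import lra zify.

Set Implicit Arguments.
Unset Strict Implicit.
Unset Printing Implicit Defensive.

Import Order.TTheory GRing.Theory Num.Theory.
Import numFieldNormedType.Exports.

Local Open Scope classical_set_scope.
Local Open Scope ring_scope.

(** A nonzero vector x of X has a nonzero coordinate x_m, and iterating the shift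
    moves the term x_m e_m along the basis: the coordinate of index m - j of
    B^j x, times e_(m-j), is x_m B^j e_m (lemma [gl_pow_coord_term]).  After
    replacing x by B^m x, which only translates the orbit, one may take m = 0.
    Up to a nonzero factor, then, the whole orbit of e_0 is read off from the
    orbit of x, one coordinate at a time.

    What makes this quantitative is that the maps y |-> y_i e_i are equicontinuous:
    for every k there are l and D with |y_i| p_k(e_i) <= D p_l(y) for all i and y
    ([basis_terms_equicontinuous]).  This is where completeness enters.  The terms
    of the basis expansion of y tend to 0, so they are bounded for each y, and
    the uniform boundedness principle ([uniform_boundedness]) upgrades the
    pointwise bound to a continuous one.  Hence p_k(B^j e_0) <= D p_l(B^(j+m) x)
    for all j ([orbit_e0_dominated]).

    The statement is thereby reduced to the single vector e_0.  The two averages of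
    the criterion are those of p_k along the forward and backward orbits of e_0,
    since B^n e_0 = w_0 ... w_(-n+1) e_(-n) and B^(-n) e_0 = e_n / (w_1 ... w_n).
    If either is unbounded then so are the two-sided averages of p_l along the
    orbit of any x <> 0, because translating the window by m changes its length by a
    bounded factor ([bounded_averages_shift]).  Conversely, if both are bounded
    for every k, adding them bounds the two-sided averages along the orbit of e_0,
    so that average expansivity fails at e_0. *)

(** * Real and complex scalars *)

Section Scalars.
Variables (R : realType) (kd : scalar_kind).
Local Notation K := (scalar_field R kd).

Definition real_scalar (t : R) : K :=
  match kd return scalar_field R kd with
  | RealScalars => t
  | ComplexScalars => complex.Complex t 0
  end.

Lemma modulus_ge0 (a : K) : 0 <= modulus a.
Proof.
by move: a; case: kd => /= [|[? ?]] *; rewrite ?normr_ge0 ?sqrtr_ge0.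
Qed.

Lemma modulus_eq0 (a : K) : modulus a = 0 -> a = 0.
Proof.
move: a; case: kd => /= a; first by move/normr0P/eqP.
exact: complex.ComplexField.Normc.eq0_normc.
Qed.

Lemma modulus_gt0 (a : K) : a != 0 -> 0 < modulus a.
Proof.
move=> a0; rewrite lt0r modulus_ge0 andbT.
by apply: contraNN a0 => /eqP/modulus_eq0/eqP.
Qed.

Lemma modulusM (a b : K) : modulus (a * b) = modulus a * modulus b.
Proof.
move: a b; case: kd => /= a b; first exact: normrM.
exact: complex.ComplexField.Normc.normcM.
Qed.

Lemma ler_modulusD (a b : K) : modulus (a + b) <= modulus a + modulus b.
Proof.
move: a b; case: kd => /= a b; first exact: ler_normD.
exact: complex.le_normcD.
Qed.

Lemma modulus1 : modulus (1 : K) = 1.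
Proof. by case: kd; [exact: normr1 | exact: complex.ComplexField.Normc.normc1]. Qed.

Lemma modulus0 : modulus (0 : K) = 0.
Proof. by case: kd; [exact: normr0 | exact: complex.ComplexField.Normc.normc0]. Qed.

Lemma modulusN1 : modulus (-1 : K) = 1.
Proof.
apply/eqP; rewrite -(@pexpr_eq1 _ _ 2) ?modulus_ge0//.
by rewrite expr2 -modulusM mulrNN mulr1 modulus1.
Qed.

Lemma modulusV (a : K) : a != 0 -> modulus a^-1 = (modulus a)^-1.
Proof.
move=> a0; apply: (mulfI (lt0r_neq0 (modulus_gt0 a0))).
by rewrite -modulusM !divff ?modulus1 // lt0r_neq0 // modulus_gt0.
Qed.

Lemma modulus_real_scalar t : modulus (real_scalar t) = `|t|.
Proof. by rewrite /real_scalar; case: kd => //=; rewrite expr0n addr0 sqrtr_sqr. Qed.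

Lemma real_scalar2 : real_scalar 2 = 2%:R.
Proof.
rewrite /real_scalar; case: kd => //.
by change (complex.Complex (2 : R) 0 = complex.Complex (1 + 1) (0 + 0)); rewrite addr0.
Qed.

Lemma modulus_lt1 (a : K) : `|a| < 1 -> modulus a < 1.
Proof. by move: a; case: kd => //= -[a b]; rewrite complex.ltcE /= => /andP[]. Qed.

End Scalars.

(** * Seminorms and the uniform boundedness principle *)

Section Seminorms.
Variables (R : realType) (kd : scalar_kind) (X : tvsType (scalar_field R kd)).

Lemma seminorm0 (q : X -> R) : seminorm q -> q 0 = 0.
Proof. by case=> _ _ qZ; rewrite -(scale0r (0 : X)) qZ modulus0 mul0r. Qed.

Lemma seminormN (q : X -> R) x : seminorm q -> q (- x) = q x.
Proof. by case=> _ _ qZ; rewrite -scaleN1r qZ modulusN1 mul1r. Qed.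

Lemma seminorm_distC (q : X -> R) x y : seminorm q -> q (x - y) = q (y - x).
Proof. by move=> sq; rewrite -opprB seminormN. Qed.

Lemma seminormB (q : X -> R) x y : seminorm q -> q (x - y) <= q x + q y.
Proof. by move=> sq; rewrite -(seminormN y sq); case: sq. Qed.

Lemma seminorm_triangle (q : X -> R) z x y :
  seminorm q -> q (x - y) <= q (x - z) + q (z - y).
Proof. by case=> _ qD _; rewrite -(subrKA z) qD. Qed.

Lemma seminorm_le_add (q : X -> R) x y : seminorm q -> q x <= q y + q (x - y).
Proof. by case=> _ qD _; rewrite -{1}(subrKC y x) qD. Qed.

(** A bound on a ball becomes a global estimate by homogeneity.  Scaling y so that
    q takes the value 2 M covers the case p y = 0 as well, where y cannot be
    normalised by p. *)
Lemma seminorm_dominated (q p : X -> R) (r M : R) :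
  seminorm q -> seminorm p -> 0 < r -> 0 < M ->
  (forall y, p y < r -> q y <= M) -> forall y, q y <= 2 * M / r * p y.
Proof.
move=> [q0 _ qZ] [p0 _ pZ] r0 M0 H y.
rewrite leNgt; apply/negP => Hy.
have qy : 0 < q y.
  by apply: le_lt_trans Hy; rewrite mulr_ge0 // divr_ge0 ?mulr_ge0 // ltW.
have t0 : 0 <= 2 * M / q y by rewrite divr_ge0 ?mulr_ge0 // ltW.
have := H (real_scalar kd (2 * M / q y) *: y).
rewrite pZ qZ modulus_real_scalar ger0_norm // mulrVK ?unitfE ?gt_eqF // => H'.
suff : 2 * M <= M by lra.
apply: H'; rewrite mulrAC ltr_pdivrMr //.
by move: Hy; rewrite mulrAC ltr_pdivrMr // [r * _]mulrC.
Qed.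

Section Fundamental.
Variable p : nat -> X -> R.
Hypothesis p_seminorm : forall k, seminorm (p k).
Hypothesis p_increasing : forall k l, (k <= l)%N -> forall x, p k x <= p l x.
Hypothesis p_topology : induces_topology p.

Lemma nbhs_increasing_seminorms (x : X) (U : set X) :
  nbhs x U <-> exists k, exists2 r, 0 < r & [set y | p k (y - x) < r] `<=` U.
Proof.
rewrite p_topology; split=> [[s [r [r0 sU]]]|[k [r r0 kU]]].
  exists (\max_(i <- s) i)%N, r => // y /= yr; apply: sU => /=.
  apply/allP => i si; apply: le_lt_trans yr; apply: p_increasing.
  exact: leq_bigmax_seq.
by exists [:: k], r; split => // y /=; rewrite andbT => /kU.
Qed.

(** Baire's argument, carried out with nested balls.  If no estimate held, every
    p l-ball about 0 would contain vectors at which some q j is as large as desired.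
    One of the two vectors x + y and x - y has a q j at least as large as that of
    y, so the centre x of any ball can be moved slightly to a point where some q j
    is large; by continuity of q j this persists on a smaller ball.  A point common
    to the resulting nested sequence contradicts the pointwise bound. *)
Lemma uniform_boundedness (J : Type) (q : J -> X -> R) :
  tvs_complete X -> (forall j, seminorm (q j)) ->
  (forall j, exists l C, forall y, q j y <= C * p l y) ->
  (forall x, exists M, forall j, q j x <= M) ->
  exists l, exists2 C, 0 < C & forall j x, q j x <= C * p l x.
Proof.
move=> X_complete q_semi q_cont q_bnd; apply: contrapT => H.
have big l r M : 0 < r -> 0 < M -> exists y j, p l y < r /\ M < q j y.
  move=> r0 M0; apply: contrapT => nH; apply: H; exists l.
  exists (2 * M / r) => [|j]; first by rewrite divr_gt0 // mulr_gt0.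
  apply: seminorm_dominated => // y yr; rewrite leNgt; apply/negP => yM.
  by apply: nH; exists y, j.
(* A state (x, l, r) stands for the closed ball of centre x and p l-radius r. *)
pose ball (s : X * nat * R) := [set y | p s.1.2 (y - s.1.1) <= s.2].
pose ok (s : X * nat * R) : Prop := 0 < s.2 <= s.1.2.+1%:R^-1.
pose step (s t : X * nat * R) := [/\ (s.1.2 < t.1.2)%N, ball t `<=` ball s &
  exists j, forall y, ball t y -> s.1.2%:R < q j y].
have next (s : {s | ok s}) : {t : {t | ok t} | step (sval s) (sval t)}.
  apply: cid; case: s => -[[x l] r] /= /andP[/= r0 rl].
  have [y [j [yr yM]]] := big l (r / 2) (l%:R + 1) ltac:(lra) ltac:(exact: ltr_wpDl).
  (* 2 y is the difference of x + y and x - y, so q j cannot be small at both. *)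
  have [x' x'r x'M] : exists2 x', p l (x' - x) < r / 2 & l%:R + 1 < q j x'.
    have [xM|xM] := ltP (l%:R + 1) (q j (x + y)).
      by exists (x + y) => //; rewrite addrAC subrr add0r.
    exists (x - y); first by rewrite addrAC subrr add0r seminormN.
    have : q j (y *+ 2) <= q j (x + y) + q j (x - y).
      apply: le_trans (seminormB _ _ (q_semi j)).
      by rewrite opprB addrC addrA subrK mulr2n.
    have [_ _ qZ] := q_semi j.
    rewrite -scaler_nat -real_scalar2.
    by rewrite qZ modulus_real_scalar ger0_norm //; lra.
  have [l1 [C qC]] := q_cont j.
  (* On the ball of radius 1 / (|C| + 1) for p l1, q j varies by at most 1, which
     is the margin kept in the choice of y. *)
  pose l' := maxn l.+1 l1.
  pose r' := Num.min (r / 2) (Num.min l'.+1%:R^-1 (`|C| + 1)^-1).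
  have C0 : 0 < `|C| + 1 by rewrite ltr_wpDl.
  have ok' : ok (x', l', r').
    by rewrite /ok /= /r' !lt_min !ge_min lexx orbT andbT divr_gt0 // !invr_gt0 C0 ltr0n.
  exists (exist ok _ ok'); split => /=; first exact: leq_maxl.
    move=> z /=; rewrite /ball /= => zx'.
    have := p_increasing (leq_trans (leqnSn l) (leq_maxl l.+1 l1)) (z - x').
    have : r' <= r / 2 by rewrite ge_min lexx.
    have := seminorm_triangle x' z x (p_seminorm l).
    rewrite -/l'; lra.
  exists j => z; rewrite /ball /= => zx'.
  have := qC (x' - z); have := seminorm_le_add x' z (q_semi j).
  have := p_increasing (leq_maxr l.+1 l1) (x' - z); rewrite -/l'.
  move=> h1 h2 h3.
  have : C * p l1 (x' - z) <= 1.
    have pz : 0 <= p l1 (x' - z) by case: (p_seminorm l1).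
    have : `|C| * p l1 (x' - z) <= `|C| * (`|C| + 1)^-1.
      apply: ler_wpM2l => //; apply: (le_trans h1); rewrite seminorm_distC //.
      apply: (le_trans zx').
      by rewrite !ge_min lexx !orbT.
    have : C * p l1 (x' - z) <= `|C| * p l1 (x' - z) by rewrite ler_wpM2r ?ler_norm.
    have : `|C| / (`|C| + 1) <= 1 by rewrite ler_pdivrMr // mul1r lerDl.
    lra.
  lra.
have ok0 : ok (0, 0%N, 1) by rewrite /ok /= ltr01 invr1 lexx.
have [s [_ sS]] := dependent_choice next (exist ok _ ok0).
pose x n := (sval (s n)).1.1; pose l n := (sval (s n)).1.2; pose r n := (sval (s n)).2.
have ln n : (n <= l n)%N.
  by elim: n => // n ih; apply: leq_ltn_trans ih _; case: (sS n).
have r_small n : 0 < r n <= n.+1%:R^-1.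
  have /andP[-> /le_trans->//] := svalP (s n).
  by rewrite lef_pV2 ?posrE // ler_nat ltnS ln.
have nested n m : (n <= m)%N -> ball (sval (s m)) `<=` ball (sval (s n)).
  move=> /subnKC <-; elim: (m - n)%N => [|d ih]; first by rewrite addn0.
  by rewrite addnS; apply: subset_trans ih; case: (sS (n + d)%N).
have center n m : (n <= m)%N -> p (l n) (x m - x n) <= r n.
  move=> nm; apply: (nested _ _ nm); rewrite /ball /= subrr seminorm0 //.
  by have /andP[/ltW] := r_small m.
(* The centres form a Cauchy sequence; its limit lies in all the balls. *)
have [|z xz] := X_complete (x @ \oo) _.
  move=> U /nbhs_increasing_seminorms[k [e e0 kU]].
  have [N [kN rN]] : exists N, (k <= N)%N /\ r N < e / 2.
    have e2 : 0 < e / 2 by lra.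
    have [N _ Ne] := near_infty_natSinv_lt (PosNum e2).
    exists (maxn k N); rewrite leq_maxl; split => //.
    have /andP[_ /le_lt_trans] := r_small (maxn k N).
    by apply; apply: Ne; exact: leq_maxr.
  exists [set y | p (l N) (y - x N) <= r N].
    by exists N => // m /= Nm; exact: center.
  move=> a b /= aN bN; apply: kU => /=; rewrite subr0.
  apply: le_lt_trans (p_increasing (leq_trans kN (ln N)) _) _.
  have := seminorm_triangle (x N) a b (p_seminorm (l N)).
  rewrite (seminorm_distC (x N) b) //; lra.
have z_ball n : ball (sval (s n)) z.
  rewrite /ball /=; apply/ler_addgt0Pr => e e0.
  have [|N _ /(_ (maxn n N) (leq_maxr _ _)) /= xN] := xz [set y | p (l n) (y - z) < e].
    by apply/nbhs_increasing_seminorms; exists (l n), e.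
  have := seminorm_triangle (x (maxn n N)) z (x n) (p_seminorm (l n)).
  have := center n _ (leq_maxl n N).
  rewrite (seminorm_distC z (x (maxn n N))) // -/(l n) -/(x n) -/(r n); lra.
have [M zM] := q_bnd z.
have := archi_boundP (normr_ge0 M); set n := Num.bound _ => Mn.
have [_ _ [j jM]] := sS n.
have := jM z (z_ball n.+1); have := zM j; have := ler_norm M.
have : n%:R <= (l n)%:R :> R by rewrite ler_nat.
rewrite -/(l n); lra.
Qed.

End Fundamental.
End Seminorms.

(** * Bilateral sums and averages *)

Section BilateralSums.

Lemma bilateral_sumSr (V : zmodType) m n (F : int -> V) :
  bilateral_sum m n.+1 F = bilateral_sum m n F + F n.+1%:Z.
Proof.
rewrite /bilateral_sum addnS big_ord_recr /=; congr (_ + F _).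
by rewrite -addnS PoszD; lia.
Qed.

Lemma bilateral_sumSl (V : zmodType) m n (F : int -> V) :
  bilateral_sum m.+1 n F = F (- m.+1%:Z) + bilateral_sum m n F.
Proof.
rewrite /bilateral_sum addSn big_ord_recl /= sub0r; congr (_ + _).
by apply: eq_bigr => i _; congr F; rewrite /bump /=; lia.
Qed.

Lemma bilateral_sum_halves (V : zmodType) n (F : int -> V) :
  bilateral_sum n n F =
  F 0 + \sum_(1 <= j < n.+1) F j%:Z + \sum_(1 <= j < n.+1) F (- j%:Z).
Proof.
elim: n => [|n ih].
  by rewrite /bilateral_sum big_ord_recl big_ord0 !big_geq // subr0 !addr0.
rewrite bilateral_sumSr bilateral_sumSl ih !(@big_nat_recr _ _ _ n.+1) //=.
by rewrite [LHS](AC (1*3*1) ((2*(3*5))*(4*1))).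
Qed.

Lemma bilateral_sum_opp (V : zmodType) n (F : int -> V) :
  bilateral_sum n n (fun j => F (- j)) = bilateral_sum n n F.
Proof.
rewrite !bilateral_sum_halves addrAC oppr0; congr (_ + _ + _).
by apply: eq_bigr => j _; rewrite opprK.
Qed.

(** The indices m + 1, ..., m + n all lie in the window [-(n + |m|), n + |m|]. *)
Lemma sum_le_bilateral_sum (R : realType) (F : int -> R) (m : int) (n : nat) :
  (forall j, 0 <= F j) ->
  \sum_(1 <= j < n.+1) F (j%:Z + m) <= bilateral_sum (n + `|m|) (n + `|m|) F.
Proof.
move=> F0; set N := (n + `|m|)%N.
rewrite /bilateral_sum -(big_mkord xpredT (fun i => F (i%:Z - N%:Z))).
pose d := `|(m + N%:Z)%R|%N.
have -> : \sum_(1 <= j < n.+1) F (j%:Z + m) =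
          \sum_(1 + d <= i < n.+1 + d) F (i%:Z - N%:Z).
  rewrite big_addn addnK; apply: eq_bigr => i _; congr F.
  by rewrite /d /N; lia.
rewrite [leRHS](@big_cat_nat _ _ _ (1 + d)) //=; last by rewrite /d /N; lia.
rewrite [X in _ <= _ + X](@big_cat_nat _ _ _ (n.+1 + d)) //=; [|lia|rewrite /d /N; lia].
by rewrite addrCA lerDl addr_ge0 // sumr_ge0.
Qed.

Lemma ereal_sup_pinfty (R : realType) (u : nat -> R) :
  ereal_sup [set (u n)%:E | n in [set n | (0 < n)%N]] = +oo%E <->
  ~ exists M, forall n, (0 < n)%N -> u n <= M.
Proof.
split=> [uoo [M uM]|nb].
  have : (ereal_sup [set (u n)%:E | n in [set n | (0 < n)%N]] <= M%:E)%E.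
    by apply/ge_ereal_sup => _ /= [n n0 <-]; rewrite lee_fin uM.
  by rewrite uoo.
rewrite -(image_comp u EFin); apply: hasNub_ereal_sup.
  by move=> [M uM]; apply: nb; exists M => n n0; apply: uM; exists n.
by exists (u 1%N), 1%N.
Qed.

(** The window that contains the translate by m of {1, ..., n} has
    2 (n + |m|) + 1 <= (2 |m| + 3) n points, so boundedness of averages survives
    the translation. *)
Lemma bounded_averages_shift (R : realType) (a b : int -> R) (m : int) (D : R) :
  (forall j, 0 <= b j) -> 0 < D -> (forall j, a j <= D * b (j + m)) ->
  (exists M, forall n, (0 < n)%N ->
     (2 * n + 1)%:R^-1 * bilateral_sum n n b <= M) ->
  exists M, forall n, (0 < n)%N -> n%:R^-1 * \sum_(1 <= j < n.+1) a j%:Z <= M.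
Proof.
move=> b0 D0 ab [M bM]; exists (D * (`|M| * (2 * `|m| + 3)%:R)) => n n0.
have n0' : 0 < n%:R :> R by rewrite ltr0n.
rewrite ler_pdivrMl //.
have : \sum_(1 <= j < n.+1) a j%:Z <= D * \sum_(1 <= j < n.+1) b (j%:Z + m).
  by rewrite mulr_sumr; apply: ler_sum.
move=> /le_trans; apply; rewrite mulrCA ler_pM2l //.
apply: (le_trans (sum_le_bilateral_sum m n b0)).
have := bM (n + `|m|)%N ltac:(lia).
rewrite ler_pdivrMl ?ltr0n ?addn1 // => /le_trans; apply.
apply: le_trans (_ : _ <= (2 * (n + `|m|)).+1%:R * `|M|) _.
  by rewrite ler_pM2l ?ltr0n // ler_norm.
rewrite mulrCA mulrC ler_wpM2l // -natrM ler_nat; nia.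
Qed.

End BilateralSums.

(** * Integer powers of an invertible operator *)

Section Powers.
Variables (K : numFieldType) (X : tvsType K) (T : GL X).

(** Two-sided orbits are determined by one of their points.  The algebraic rules for
    [gl_pow] below follow by exhibiting each side as an orbit of T. *)
Lemma gl_pow_orbit (f : int -> X) :
  (forall j, T (f j) = f (j + 1)) -> forall j, gl_pow T j (f 0) = f j.
Proof.
move=> fT.
have fV j : gl_inv T (f j) = f (j - 1).
  by rewrite -{1}(subrK 1 j) -fT gl_funK.
case=> n; elim: n => [//|n /= ih] /=.
- by rewrite ih fT; congr f; lia.
- by rewrite fV; congr f.
- by rewrite ih fV; congr f; lia.
Qed.

Lemma gl_powS j x : T (gl_pow T j x) = gl_pow T (j + 1) x.
Proof.
case: j => n; first by rewrite -PoszD addn1.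
have -> : Negz n + 1 = - n%:Z by lia.
by case: n => [|n] /=; rewrite gl_invK.
Qed.

Lemma gl_powD i j x : gl_pow T (i + j) x = gl_pow T i (gl_pow T j x).
Proof.
have := @gl_pow_orbit (fun i => gl_pow T (i + j) x) _ i; rewrite add0r => <- //.
by move=> k; rewrite gl_powS addrAC.
Qed.

Lemma gl_powZ j a x : gl_pow T j (a *: x) = a *: gl_pow T j x.
Proof.
by apply: (@gl_pow_orbit (fun j => a *: gl_pow T j x)) => k; rewrite linearZ gl_powS.
Qed.

Lemma gl_powK j : cancel (gl_pow T j) (gl_pow T (- j)).
Proof. by move=> x; rewrite -gl_powD addNr. Qed.

Lemma gl_pow_neq0 j x : x != 0 -> gl_pow T j x != 0.
Proof.
apply: contraNN => /eqP jx; rewrite -(gl_powK j x) jx.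
by rewrite -(scale0r x) gl_powZ !scale0r.
Qed.

End Powers.

(** * Coordinates and the canonical basis *)

Section SequenceSpaces.
Variables (R : realType) (kd : scalar_kind).
Local Notation K := (scalar_field R kd).
Variables (P : pred (int -> K)) (X : tvsSeqType P).

Definition coord (i : int) (x : X) : K := (\val x : int -> K) i.

Lemma coord_inj (x y : X) : (forall i, coord i x = coord i y) -> x = y.
Proof. by move=> xy; apply: val_inj; apply/funext. Qed.

Lemma coordD i (x y : X) : coord i (x + y) = coord i x + coord i y.
Proof. by rewrite /coord raddfD. Qed.

Lemma coordZ i a (x : X) : coord i (a *: x) = a * coord i x.
Proof. by rewrite /coord linearZ. Qed.

Lemma coord0 i : coord i (0 : X) = 0.
Proof. by rewrite /coord raddf0. Qed.

Variable p : nat -> X -> R.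
Hypothesis p_seminorm : forall k, seminorm (p k).
Hypothesis p_increasing : forall k l, (k <= l)%N -> forall x, p k x <= p l x.
Hypothesis p_topology : induces_topology p.

Lemma seminorm_coord i (c : R) : 0 <= c -> seminorm (fun x => modulus (coord i x) * c).
Proof.
move=> c0; split=> [x|x y|a x]; first by rewrite mulr_ge0 ?modulus_ge0.
  by rewrite coordD -mulrDl ler_wpM2r ?ler_modulusD.
by rewrite coordZ modulusM mulrA.
Qed.

(** By continuity at 0, a coordinate has modulus less than 1 on a neighbourhood of 0,
    hence on a ball of some p l; homogeneity does the rest. *)
Lemma coord_dominated i :
  continuous (\val : X -> prod_topology (fun _ : int => K)) ->
  exists l C, forall y, modulus (coord i y) <= C * p l y.
Proof.
move=> val_cont.
have ci : continuous (fun x : X => coord i x).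
  move=> x; apply: (@continuous_comp _ _ _
    (\val : X -> prod_topology (fun _ : int => K)) (proj i)).
    exact: val_cont.
  exact: proj_continuous.
have /(nbhs_increasing_seminorms p_increasing p_topology)[l [r r0 lr]] :
    nbhs (0 : X) [set y | `|coord i y| < 1].
  have := ci 0 [set a | `|a| < 1]; apply; rewrite coord0.
  exact: (@nbhs0_lt _ K).
exists l, (2 * 1 / r) => y.
rewrite -[leLHS]mulr1.
apply: (seminorm_dominated (seminorm_coord i ler01) (p_seminorm l) r0 ltr01) => z zr.
by rewrite mulr1 ltW // modulus_lt1 //; apply: lr; rewrite /= subr0.
Qed.

Variable e : int -> X.
Hypothesis e_basis : canonical_basis e.

Lemma coord_e i j : coord i (e j) = (i == j)%:R.
Proof. by rewrite /coord (proj1 e_basis). Qed.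

(** Each term of the expansion of x is a difference of two consecutive partial sums;
    if its index exceeds N in absolute value, both of these sums can be taken close
    to x, the other end of the range of summation being kept at N. *)
Lemma basis_terms_bounded k (x : X) :
  exists M, forall j, modulus (coord j x) * p k (e j) <= M.
Proof.
pose F j := coord j x *: e j.
have pF j : p k (F j) = modulus (coord j x) * p k (e j) by case: (p_seminorm k) => _ _ ->.
have F0 j : 0 <= p k (F j) by case: (p_seminorm k).
have : nbhs x [set y | p k (y - x) < 1].
  by apply/(nbhs_increasing_seminorms p_increasing p_topology); exists k, 1.
move=> /(proj2 e_basis x) [[A1 A2] /= [[N1 _ AN1] [N2 _ AN2]] A12].
pose N := maxn N1 N2.
have near m n : (N <= m)%N -> (N <= n)%N -> p k (bilateral_sum m n F - x) < 1.
  move=> Nm Nn; apply: (A12 (m, n)); split => /=.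
    by apply: AN1; rewrite /= (leq_trans _ Nm) // leq_maxl.
  by apply: AN2; rewrite /= (leq_trans _ Nn) // leq_maxr.
have near2 m n m' n' : (N <= m)%N -> (N <= n)%N -> (N <= m')%N -> (N <= n')%N ->
    p k (bilateral_sum m n F - bilateral_sum m' n' F) < 2.
  move=> h1 h2 h3 h4; have := near m n h1 h2; have := near m' n' h3 h4.
  have := seminorm_triangle x (bilateral_sum m n F) (bilateral_sum m' n' F)
    (p_seminorm k).
  rewrite (seminorm_distC x) //; lra.
exists (2 + bilateral_sum N N (fun j => p k (F j))) => j; rewrite -pF.
have S0 : 0 <= bilateral_sum N N (fun j => p k (F j)) by apply: sumr_ge0.
have [jN|jN] := leqP `|j|%N N.
  have jb : (`|(j + N%:Z)%R| < (N + N).+1)%N by lia.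
  rewrite /bilateral_sum (bigD1 (Ordinal jb)) //=.
  have -> : `|(j + N%:Z)%R|%N%:Z - N%:Z = j by lia.
  by rewrite addrCA lerDl addr_ge0 // sumr_ge0.
suff : p k (F j) < 2 by lra.
case: j jN => n jN.
  case: n jN => // n jN.
  have := near2 N n.+1 N n (leqnn _) ltac:(lia) (leqnn _) ltac:(lia).
  by rewrite bilateral_sumSr addrAC subrr add0r.
have := near2 n.+1 N n N ltac:(lia) (leqnn _) ltac:(lia) (leqnn _).
by rewrite bilateral_sumSl addrK NegzE.
Qed.

(** The family indexed by j of the seminorms x |-> p k (x_j e_j) is pointwise bounded
    and each member is continuous, so the uniform boundedness principle applies. *)
Lemma basis_terms_equicontinuous k :
  is_frechet_sequence_space R X ->
  exists l, exists2 D, 0 < D &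
    forall j x, modulus (coord j x) * p k (e j) <= D * p l x.
Proof.
move=> [[_ X_complete] val_cont].
apply: (uniform_boundedness p_seminorm p_increasing p_topology X_complete
  (q := fun j x => modulus (coord j x) * p k (e j))).
- by move=> j; apply: seminorm_coord; case: (p_seminorm k).
- move=> j; have [l [C lC]] := coord_dominated j val_cont.
  exists l, (C * p k (e j)) => y; rewrite mulrAC ler_wpM2r //.
  by case: (p_seminorm k).
- exact: basis_terms_bounded.
Qed.

(** * Orbits of the weighted shift *)

Variables (w : int -> K) (B : GL X).
Hypothesis w_neq0 : forall j, w j != 0.
Hypothesis B_shift : forall x : X, \val (B x) = weighted_backward_shift w (\val x).

Lemma coord_shift i x : coord i (B x) = w (i + 1) * coord (i + 1) x.
Proof. by rewrite /coord B_shift. Qed.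

Lemma shift_e j : B (e j) = w j *: e (j - 1).
Proof.
apply: coord_inj => i; rewrite coord_shift coordZ !coord_e.
rewrite [i == j - 1]eq_sym subr_eq eq_sym.
by case: eqP => [->|]; rewrite ?mulr1 ?mulr0.
Qed.

(** The shift sends the i-th term of x to the (i - 1)-st term of B x, so both sides
    are orbits of B through the i-th term of x. *)
Lemma gl_pow_coord_term i j x :
  gl_pow B j (coord i x *: e i) =
  coord (i - j) (gl_pow B j x) *: e (i - j).
Proof.
have := @gl_pow_orbit _ _ B (fun j => coord (i - j) (gl_pow B j x) *: e (i - j)) _ j.
rewrite subr0; apply => k.
rewrite linearZ /= shift_e scalerA -gl_powS coord_shift.
have -> : i - (k + 1) + 1 = i - k by lia.
by rewrite mulrC; congr (_ *: e _); lia.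
Qed.

Lemma gl_pow_e0 (n : nat) :
  gl_pow B n (e 0) = (\prod_(0 <= i < n) w (- i%:Z)) *: e (- n%:Z).
Proof.
elim: n => [|n ih]; first by rewrite big_geq // scale1r.
rewrite -addn1 PoszD -gl_powS ih linearZ /= shift_e scalerA addn1 big_nat_recr //=.
by congr (_ *: e _); lia.
Qed.

Lemma gl_powN_e0 (n : nat) :
  gl_pow B (- n%:Z) (e 0) = (\prod_(1 <= i < n.+1) w i%:Z)^-1 *: e n.
Proof.
have prod_neq0 : \prod_(1 <= i < n.+1) w i%:Z != 0.
  by rewrite prodf_seq_neq0; apply/allP => i _; rewrite w_neq0 implybT.
apply: (can_inj (gl_powK B n)); rewrite -gl_powD subrr gl_powZ.
have -> : gl_pow B n (e n) = (\prod_(1 <= i < n.+1) w i%:Z) *: e 0.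
  elim: (n) => [|m ih]; first by rewrite big_geq // scale1r.
  rewrite -{1}[m.+1]addn1 PoszD gl_powD [gl_pow B 1 _]shift_e.
  have -> : m.+1%:Z - 1 = m by lia.
  by rewrite gl_powZ ih scalerA [in RHS]big_nat_recr //= mulrC.
by rewrite scalerA mulVf // scale1r.
Qed.

(** Every nonzero orbit controls that of e_0: with y = B^m x and y_0 <> 0, the vector
    y_0 B^j e_0 is the term of index -j of B^j y, and p_k of that term is at most
    D p_l(B^j y), with D independent of j. *)
Lemma orbit_e0_dominated k x :
  is_frechet_sequence_space R X -> x != 0 ->
  exists l m, exists2 D, 0 < D &
    forall j, p k (gl_pow B j (e 0)) <= D * p l (gl_pow B (j + m) x).
Proof.
move=> X_frechet x0.
have [m xm] : exists m, coord m x != 0.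
  apply: contrapT => nx; case/eqP: x0; apply: coord_inj => i.
  by rewrite coord0; apply/eqP; apply/negPn/negP => xi; apply: nx; exists i.
have [l [D D0 lD]] := basis_terms_equicontinuous k X_frechet.
pose y := gl_pow B m x.
have y0 : coord 0 y != 0.
  apply/eqP => y0; have /eqP := gl_pow_coord_term m m x.
  rewrite subrr -/y y0 scale0r; apply/negP/gl_pow_neq0.
  apply/eqP => /(congr1 (coord m)); rewrite coordZ coord_e eqxx mulr1 coord0.
  exact/eqP.
have y0' := modulus_gt0 y0.
exists l, m, (D / modulus (coord 0 y)) => [|j]; first exact: divr_gt0.
have := lD (- j) (gl_pow B j y).
rewrite /y -gl_powD mulrAC ler_pdivlMr // => /(le_trans _); apply.
have [_ _ pZ] := p_seminorm k.
by rewrite mulrC -!pZ -gl_powZ gl_pow_coord_term sub0r gl_powD.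
Qed.

End SequenceSpaces.

Theorem theorem4 (R : realType) (kd : scalar_kind)
    (P : pred (int -> scalar_field R kd)) (X : tvsSeqType P)
    (e : int -> X) (p : nat -> X -> R) (w : int -> scalar_field R kd) (B : GL X)
    (X_frechet : is_frechet_sequence_space R X)
    (e_basis : canonical_basis e)
    (p_seminorm : forall k, seminorm (p k))
    (p_increasing : forall k l, (k <= l)%N -> forall x, p k x <= p l x)
    (p_topology : induces_topology p)
    (w_neq0 : forall j, w j != 0)
    (B_shift : forall x : X, \val (B x) = weighted_backward_shift w (\val x)) :
  average_expansive p B <->
  exists k : nat,
    ereal_sup
      [set (n%:R^-1
              * \sum_(1 <= j < n.+1)
                  modulus (\prod_(0 <= i < j) w (- i%:Z)) * p k (e (- j%:Z)))%:E
      | n in [set n | (0 < n)%N]] = +oo%E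
    \/
    ereal_sup
      [set (n%:R^-1
              * \sum_(1 <= j < n.+1)
                  p k (e j%:Z) / modulus (\prod_(1 <= i < j.+1) w i%:Z))%:E
      | n in [set n | (0 < n)%N]] = +oo%E.
Proof.
have orbit_fwd k (j : nat) : p k (gl_pow B j (e 0)) =
    modulus (\prod_(0 <= i < j) w (- i%:Z)) * p k (e (- j%:Z)).
  by case: (p_seminorm k) => _ _ pZ; rewrite (gl_pow_e0 e_basis B_shift) pZ.
have orbit_bwd k (j : nat) : p k (gl_pow B (- j%:Z) (e 0)) =
    p k (e j%:Z) / modulus (\prod_(1 <= i < j.+1) w i%:Z).
  case: (p_seminorm k) => _ _ pZ; rewrite (gl_powN_e0 e_basis w_neq0 B_shift) pZ.
  rewrite modulusV 1?mulrC // prodf_seq_neq0.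
  by apply/allP => i _; rewrite w_neq0 implybT.
have p0 k x : 0 <= p k x by case: (p_seminorm k).
have sum_fwd k n : \sum_(1 <= j < n.+1)
      modulus (\prod_(0 <= i < j) w (- i%:Z)) * p k (e (- j%:Z)) =
    \sum_(1 <= j < n.+1) p k (gl_pow B j%:Z (e 0)).
  by apply: eq_bigr => j _; rewrite orbit_fwd.
have sum_bwd k n : \sum_(1 <= j < n.+1)
      p k (e j%:Z) / modulus (\prod_(1 <= i < j.+1) w i%:Z) =
    \sum_(1 <= j < n.+1) p k (gl_pow B (- j%:Z) (e 0)).
  by apply: eq_bigr => j _; rewrite orbit_bwd.
split=> [/(_ (e 0))[] | [k k_unbounded] x x0].
- apply/eqP => /(congr1 (coord 0)); rewrite (coord_e e_basis) coord0 eqxx.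
  by apply/eqP; exact: oner_neq0.
- move=> k /ereal_sup_pinfty unbounded; exists k.
  apply: contrapT => /not_orP[/ereal_sup_pinfty/contrapT[M1 M1P]].
  move=> /ereal_sup_pinfty/contrapT[M2 M2P].
  apply: unbounded; exists (p k (e 0) + M1 + M2) => n n0.
  have n0' : 0 < n%:R :> R by rewrite ltr0n.
  rewrite ler_pdivrMl ?ltr0n ?addn1 // bilateral_sum_halves /=.
  have := M2P n n0; have := M1P n n0; rewrite !ler_pdivrMl // sum_fwd sum_bwd.
  set S1 := \sum_(_ <= _ < _) _; set S2 := \sum_(_ <= _ < _) _ => S1M S2M.
  have S1_ge0 : 0 <= S1 by exact: sumr_ge0.
  have S2_ge0 : 0 <= S2 by exact: sumr_ge0.
  have M1_ge0 : 0 <= M1 by rewrite -(pmulr_rge0 _ n0') (le_trans S1_ge0).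
  have M2_ge0 : 0 <= M2 by rewrite -(pmulr_rge0 _ n0') (le_trans S2_ge0).
  have q0 := mulr_ge0 (ltW n0') (p0 k (e 0)).
  rewrite -natr1 natrM; lra.
- have [l [m [D D0 dom]]] := orbit_e0_dominated p_seminorm p_increasing p_topology
    e_basis B_shift k X_frechet x0.
  exists l; apply/ereal_sup_pinfty => bounded.
  case: k_unbounded => /ereal_sup_pinfty; apply.
    have [M bM] := bounded_averages_shift (fun j => p0 l _) D0 dom bounded.
    by exists M => n n0; rewrite sum_fwd; exact: bM.
  (* The backward averages reduce to the forward ones for the reversed orbits, which
     have the same symmetric sums; the translation becomes - m. *)
  have domN j : p k (gl_pow B (- j) (e 0)) <= D * p l (gl_pow B (- (j - m)) x).
    by rewrite opprB addrC; exact: dom.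
  have [|M bM] := bounded_averages_shift (b := fun j => p l (gl_pow B (- j) x))
    (fun j => p0 l _) D0 domN.
    have [M bM] := bounded; exists M => n n0.
    by rewrite (bilateral_sum_opp _ (fun j => p l (gl_pow B j x))); exact: bM.
  by exists M => n n0; rewrite sum_bwd; exact: bM.
Qed.
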